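(* Let $L$ be a finite-dimensional Lie algebra over a field $\mathbb{F}$. Then the comaximal graph $\Gamma(L)$ is complete if and only if every nonzero proper subalgebra of $L$ is one-dimensional.
   Context: The comaximal graph $\Gamma(L)$ of a finite-dimensional Lie algebra $L$ is the simple undirected graph whose vertices are the nonzero proper Lie subalgebras of $L$, two distinct vertices $A,B$ being adjacent if and only if $\langle A,B\rangle=L$, where $\langle A,B\rangle$ denotes the Lie subalgebra generated by $A\cup B$. A graph is complete if every two distinct vertices are adjacent (the graph with no vertices counts as complete). *)

(* Defs.v *)
From HB Require Import structures.
From mathcomp Require Import all_boot all_order all_algebra.

Set Implicit Arguments.
Unset Strict Implicit.
Unset Printing Implicit Defensive.

Import GRing.Theory.
Local Open Scope ring_scope.

(* The bracket is alternating ([x, x] = 0), not merely antisymmetric: the base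
   field may have characteristic 2. *)
HB.mixin Record Vector_isLieAlgebra (F : fieldType) L of Vector F L := {
  lie : L -> L -> L;
  lie_linearl : forall y : L, linear (lie^~ y);
  lie_linearr : forall x : L, linear (lie x);
  liexx : forall x : L, lie x x = 0;
  lie_jacobi : forall x y z : L,
    lie x (lie y z) + lie y (lie z x) + lie z (lie x y) = 0
}.

#[short(type="finLieAlgType")]
HB.structure Definition FinLieAlgebra (F : fieldType) :=
  { L of Vector_isLieAlgebra F L & Vector F L }.

Section LieSubalgebras.
Variables (F : fieldType) (L : finLieAlgType F).

Definition lie_subalgebra (A : {vspace L}) : Prop :=
  {in A &, forall x y, lie x y \in A}.

Definition nonzero_proper_subalgebra (A : {vspace L}) : Prop :=
  [/\ lie_subalgebra A, A <> 0%VS & A <> fullv].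

(* The subalgebra generated by X, as the intersection of all the subalgebras
   containing X. It is given by its membership predicate, since the intersected
   family may be infinite. *)
Definition lie_generated (X : {pred L}) (x : L) : Prop :=
  forall C : {vspace L}, lie_subalgebra C -> {subset X <= C} -> x \in C.

Definition lie_generates (A B : {vspace L}) : Prop :=
  forall x : L, lie_generated [predU A & B] x.

End LieSubalgebras.

(* The vertices form a subset of an ambient type T. *)
Record simple_graph (T : Type) := SimpleGraph {
  vertex : T -> Prop;
  adjacent : T -> T -> Prop;
  adjacent_vertex : forall u v, adjacent u v -> vertex u /\ vertex v;
  adjacent_sym : forall u v, adjacent u v -> adjacent v u;
  adjacent_irrefl : forall u, ~ adjacent u u
}.

Definition complete_graph (T : Type) (G : simple_graph T) : Prop :=
  forall u v : T, vertex G u -> vertex G v -> u <> v -> adjacent G u v.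

Section ComaximalGraph.
Variables (F : fieldType) (L : finLieAlgType F).

Definition comaximal (A B : {vspace L}) : Prop :=
  [/\ nonzero_proper_subalgebra A, nonzero_proper_subalgebra B,
      A <> B & lie_generates A B].

Lemma comaximal_vertex A B : comaximal A B ->
  nonzero_proper_subalgebra A /\ nonzero_proper_subalgebra B.
Proof. by case. Qed.

Lemma comaximal_sym A B : comaximal A B -> comaximal B A.
Proof.
case=> vA vB neqAB genAB; split=> // [eqBA | x C subC sBAC].
  exact: neqAB (esym eqBA).
by apply: genAB subC _ => y yAB; apply: sBAC; move: yAB; rewrite !inE orbC.
Qed.

Lemma comaximal_irrefl A : ~ comaximal A A.
Proof. by case. Qed.

Definition comaximal_graph : simple_graph {vspace L} :=
  SimpleGraph comaximal_vertex comaximal_sym comaximal_irrefl.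

End ComaximalGraph.

Arguments comaximal_graph {F} L.

(* Main.v *)
Require Import Defs.
From mathcomp Require Import all_boot all_order all_algebra.

Import GRing.Theory.
Local Open Scope ring_scope.

(** Every vector spans a subalgebra. If a vertex A is not a line, the line of a nonzero vector of A
    is another vertex; together they generate only A, not L, so the graph is not complete.
    Conversely, if all vertices are lines, a proper subalgebra containing vertices A and B is itself
    a line, hence equals both; so distinct A and B generate L. *)

(** By bilinearity, brackets of multiples of [v] are multiples of [lie v v], which is 0. *)
Lemma lie_subalgebra_line (F : fieldType) (L : finLieAlgType F) (v : L) :
  lie_subalgebra <[v]>%VS.
Proof.
move=> _ _ /vlineP[a ->] /vlineP[b ->].
suff -> : lie (a *: v) (b *: v) = 0 by exact: mem0v.
have linr x c y : lie x (c *: y) = c *: lie x y.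
  (* Linearity with scalar -1 at zero vectors makes the two copies of [lie x 0] cancel. *)
  have lin0 : lie x 0 = 0.
    by have := lie_linearr x (-1) 0 0; rewrite scaler0 addr0 scaleN1r addNr.
  by have := lie_linearr x c y 0; rewrite lin0 !addr0.
have linl x c y : lie (c *: y) x = c *: lie y x.
  have lin0 : lie 0 x = 0.
    by have := lie_linearl x (-1) 0 0; rewrite scaler0 addr0 scaleN1r addNr.
  by have := lie_linearl x c y 0; rewrite lin0 !addr0.
by rewrite linr linl liexx !scaler0.
Qed.

Theorem theorem3p3 (F : fieldType) (L : finLieAlgType F) :
  complete_graph (comaximal_graph L) <->
  (forall A : {vspace L}, nonzero_proper_subalgebra A -> \dim A = 1%N).
Proof.
split=> [complL A vA | dim1 A B vA vB neqAB].
- have [subA nzA propA] := vA.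
  (* A line inside A generates together with A nothing more than A. *)
  have v_neq0 : vpick A != 0 by rewrite vpick0; apply/eqP.
  have vlineA : (<[vpick A]> <= A)%VS by rewrite -memvE memv_pick.
  have [eqA | /eqP neqA] := eqVneq <[vpick A]>%VS A.
    by rewrite -eqA dim_vline v_neq0.
  have vline : nonzero_proper_subalgebra <[vpick A]>%VS.
    split; first exact: lie_subalgebra_line.
      by move/eqP; rewrite -dimv_eq0 dim_vline v_neq0.
    move=> eqL; apply: propA; apply/eqP.
    by rewrite eqEsubv subvf -eqL.
  have [_ _ _ genL] := complL _ _ vline vA neqA.
  case: propA; apply/eqP; rewrite eqEsubv subvf /=; apply/subvP=> x _.
  by apply: genL => // y; rewrite !inE => /orP[/(subvP vlineA)|].
(* The generated subalgebra is an intersection, so it suffices that each subalgebra [C] containing A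
   and B is all of L. *)
- split=> // x C subC sABC.
  have sAC : (A <= C)%VS by apply/subvP=> y yA; apply: sABC; rewrite !inE yA.
  have sBC : (B <= C)%VS
    by apply/subvP=> y yB; apply: sABC; rewrite !inE yB orbT.
  have [-> | /eqP propC] := eqVneq C fullv; first exact: memvf.
  have nzC : C <> 0%VS.
    by move=> C0; have [_ + _] := vA; apply; apply/eqP; rewrite -subv0 -C0.
  have dimC : \dim C = 1%N by apply: dim1.
  (* Inclusion with equal dimension 1 forces equality. *)
  have eqC (D : {vspace L}) :
      nonzero_proper_subalgebra D -> (D <= C)%VS -> D = C.
    by move=> vD sDC; apply/eqP; rewrite eqEdim sDC dimC (dim1 _ vD).
  by case: neqAB; rewrite (eqC _ vA sAC) (eqC _ vB sBC).
Qed.
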